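(* Let $r>1$ be a natural number. If $A$ is a closed $r$-regular subset of $[0,1]$ such that $0<d_H(A)<1$, then there is a Cantor set definable in $\mathcal{R}_A=(\mathbb{R},<,+,0,1,A)$.
   Context: Write $[r]=\{0,\dots,r-1\}$. A Büchi automaton over a finite alphabet $\Sigma$ is a finite automaton (finite set of states, initial state, transitions, set of accept states) reading infinite words in $\Sigma^\omega$; it accepts a word $w$ if some run on $w$ visits accept states infinitely often. A language $L\subseteq\Sigma^\omega$ is regular if it is the set of words accepted by some Büchi automaton. For $w=w_0w_1\cdots\in[r]^\omega$ put $\nu_r(w)=\sum_{i\ge0} w_i r^{-(i+1)}\in[0,1]$. A set $A\subseteq[0,1]$ is $r$-regular if $A=\nu_r(L)$ for some regular $L\subseteq[r]^\omega$. $d_H$ denotes Hausdorff dimension. A Cantor set is a nonempty subset of some $\mathbb{R}^n$ that is compact, has no isolated points and has empty interior. In $\mathcal{R}_A$ the set $A$ is named by a unary predicate; definable means first-order definable. *)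

(* Defs.v *)
From HB Require Import structures.
From mathcomp Require Import all_boot all_order all_algebra.
From mathcomp Require Import all_classical all_reals all_analysis.

Set Implicit Arguments.
Unset Strict Implicit.
Unset Printing Implicit Defensive.

Import Order.TTheory GRing.Theory Num.Theory.
Import numFieldNormedType.Exports.

Local Open Scope classical_set_scope.
Local Open Scope ring_scope.

(** Words in [Sigma^omega] are functions [nat -> Sigma]; transitions are
    nondeterministic. *)

Record buchi (Sigma : finType) := Buchi {
  buchi_state : finType;
  buchi_init : buchi_state;
  buchi_trans : buchi_state -> Sigma -> {set buchi_state};
  buchi_accept : {set buchi_state} }.

Definition buchi_run (Sigma : finType) (B : buchi Sigma) (w : nat -> Sigma)
    (rho : nat -> buchi_state B) : Prop :=
  rho 0%N = buchi_init B /\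
  forall i : nat, rho i.+1 \in buchi_trans (rho i) (w i).

Definition buchi_lang (Sigma : finType) (B : buchi Sigma) :
    set (nat -> Sigma) :=
  [set w | exists rho : nat -> buchi_state B, buchi_run w rho /\
     forall n : nat, exists2 m : nat, (n <= m)%N & rho m \in buchi_accept B].

Definition regular_lang (Sigma : finType) (L : set (nat -> Sigma)) : Prop :=
  exists B : buchi Sigma, L = buchi_lang B.

Section expansion.
Variables (R : realType) (r : nat).

Definition nu (w : nat -> 'I_r) : R :=
  limn ([series (w i)%:R / r%:R ^+ i.+1]_i : R^nat).

Definition r_regular (A : set R) : Prop :=
  exists2 L : set (nat -> 'I_r), regular_lang L & A = nu @` L.

End expansion.

Section hausdorff_dimension.
Variable R : realType.
Local Open Scope ereal_scope.

(** [diam set0 = -oo] *)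
Definition diam (U : set R) : \bar R :=
  ereal_sup [set `|p.1 - p.2|%:E | p in U `*` U].

(** The empty set contributes [0] and the exponent [0] follows the convention
    [0^0 = 1], so that the 0-dimensional measure is the counting measure. *)
Definition diam_pow (s : R) (U : set R) : \bar R :=
  if U == set0 then 0 else diam U `^ s.

Definition hausdorff_premeasure (s delta : R) (A : set R) : \bar R :=
  ereal_inf [set \sum_(k <oo) diam_pow s (U k) | U in
    [set U : nat -> set R |
      (forall k, diam (U k) <= delta%:E) /\ A `<=` \bigcup_k U k]].

(** The premeasure is nonincreasing in [delta], so its limit at [0+] is a
    supremum. *)
Definition hausdorff_measure (s : R) (A : set R) : \bar R :=
  ereal_sup [set hausdorff_premeasure s delta A |
              delta in [set delta : R | (0 < delta)%R]].

Definition hausdorff_dim (A : set R) : \bar R :=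
  ereal_inf [set s%:E | s in
              [set s : R | (0 <= s)%R /\ hausdorff_measure s A = 0]].

End hausdorff_dimension.

(** First-order formulas in the signature [(<, +, 0, 1, A)], with [A] a unary
    predicate symbol. A [formula n] has its free variables among [n] de Bruijn
    variables. *)

Inductive term (n : nat) : Type :=
| Var of 'I_n
| Zero
| One
| Plus of term n & term n.

Inductive formula (n : nat) : Type :=
| Eq of term n & term n
| Less of term n & term n
| InA of term n
| Not of formula n
| And of formula n & formula n
| Exists of formula n.+1.

Section semantics.
Variables (R : realType) (A : set R).

Fixpoint eval (n : nat) (v : 'rV[R]_n) (t : term n) : R :=
  match t with
  | Var i => v ord0 i
  | Zero => 0
  | One => 1
  | Plus t1 t2 => eval v t1 + eval v t2
  end.

(** The variable bound by [Exists] gets index [0]. *)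
Fixpoint holds (n : nat) (phi : formula n) : 'rV[R]_n -> Prop :=
  match phi with
  | Eq t1 t2 => fun v => eval v t1 = eval v t2
  | Less t1 t2 => fun v => eval v t1 < eval v t2
  | InA t => fun v => A (eval v t)
  | Not phi1 => fun v => ~ holds phi1 v
  | And phi1 phi2 => fun v => holds phi1 v /\ holds phi2 v
  | Exists phi1 => fun v =>
      exists x : R, holds phi1 (row_mx (const_mx x : 'rV[R]_1) v)
  end.

(** Definability is without parameters. *)
Definition definable (n : nat) (X : set 'rV[R]_n) : Prop :=
  exists phi : formula n, X = [set v | holds phi v].

End semantics.

(** [R^n] is ['rV[R]_n] with its product topology. *)
Definition cantor_subset (R : realType) (n : nat) (X : set 'rV[R]_n) : Prop :=
  [/\ X !=set0, compact X, isolated X = set0 & interior X = set0].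

(* Main.v *)
Require Import Defs.
From mathcomp Require Import all_boot all_order all_algebra.
From mathcomp Require Import all_classical all_reals all_analysis.
From mathcomp Require Import lra.

(** Let [A_q] be the closure of the set of values of the words accepted from
    the state [q], so that [A] is [A_q] for the initial [q]. These sets satisfy
    [A_q = \bigcup_(q -a-> q') (a + A_q') / r], and taking limit points
    commutes with finite unions and homeomorphisms, so the iterated derived
    sets [A_q^(m)] satisfy the same system. As the maps are contractions, a
    closed bounded solution is determined by the set of states [q] at which it
    is nonempty. For [A_q^(m)] this set decreases with [m], hence is
    eventually constant, and so is [A^(m)]: its final value is a perfect set.
    It is definable, since limit points are; it is nonempty, since each step
    removes countably many points and [d_H A > 0]; and it has empty interior,
    since [d_H A < 1]. The Cantor set is thus a subset of the line. *)

Set Implicit Arguments.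
Unset Strict Implicit.
Unset Printing Implicit Defensive.

Import Order.TTheory GRing.Theory Num.Theory.
Import numFieldNormedType.Exports.

Local Open Scope classical_set_scope.
Local Open Scope ring_scope.

(** * Limit points under finite unions and homeomorphisms *)

Lemma limit_point_closure (T : topologicalType) (E : set T) (x : T) :
  limit_point E x <-> closure (E `\ x) x.
Proof.
split=> [Ex U /Ex[y [yx Ey Uy]]|Ex U /Ex[y [[Ey yx] Uy]]]; exists y.
  by split => //; split => //; apply/eqP.
by split => //; apply/eqP.
Qed.

Lemma limit_pointS (T : topologicalType) (E F : set T) :
  E `<=` F -> limit_point E `<=` limit_point F.
Proof.
move=> EF x Ex U /Ex[y [yx Ey Uy]].
by exists y; split => //; exact: EF.
Qed.

Lemma closure_finite_bigcup (T : topologicalType) (I : finType) (P : set I)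
    (F : I -> set T) :
  closure (\bigcup_(i in P) F i) = \bigcup_(i in P) closure (F i).
Proof.
apply/seteqP; split.
  have cl : closed (\bigcup_(i in P) closure (F i)).
    apply: closed_bigcup => [|i _]; first exact: finite_finset.
    exact: closed_closure.
  rewrite [X in _ `<=` X](closure_id _).1//; apply: closure_subset.
  by apply: subset_bigcup => i _; exact: subset_closure.
move=> x [i Pi]; apply: closure_subset => y Fy.
by exists i.
Qed.

(** Puncturing at [x] distributes over the union, and closure commutes with finite unions. *)
Lemma limit_point_finite_bigcup (T : topologicalType) (I : finType)
    (P : set I) (F : I -> set T) :
  limit_point (\bigcup_(i in P) F i) = \bigcup_(i in P) limit_point (F i).
Proof.
apply/seteqP; split=> [x /limit_point_closure|x [i Pi]].
  rewrite setD_bigcupl closure_finite_bigcup => -[i Pi Fx].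
  by exists i => //; apply/limit_point_closure.
by apply: limit_pointS; exact: bigcup_sup.
Qed.

Section homeomorphism.
Variables (T U : topologicalType) (f : T -> U) (g : U -> T).
Hypotheses (cf : continuous f) (cg : continuous g).
Hypotheses (fK : cancel f g) (gK : cancel g f).

Lemma closure_homeo (E : set T) : closure (f @` E) = f @` closure E.
Proof.
apply/seteqP; split=> [y Ey|_ [x Ex <-] V /cf/Ex[z [Ez Vz]]].
  exists (g y) => // V /cg/Ey[_ [[z Ez <-]]] /=; rewrite fK => Vz.
  by exists z.
by exists (f z); split => //; exists z.
Qed.

Lemma limit_point_homeo (E : set T) :
  limit_point (f @` E) = f @` limit_point E.
Proof.
apply/seteqP; split=> [y Ey|_ [x Ex <-] V /cf/Ex[z [zx Ez Vz]]].
  exists (g y) => // V /cg/Ey[w [wy [z Ez zw] /=]]; rewrite -zw fK => Vz.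
  by exists z; split => //; apply: contra_neq wy => zgy; rewrite -zw zgy gK.
by exists (f z); split; [rewrite (can_eq fK)| exists z|].
Qed.

End homeomorphism.

(** * Graph-directed systems of contractions and their derived sets *)

Section graph_directed_systems.
Variables (R : realType) (r : nat) (r_gt1 : (1 < r)%N).
Variables (Q : finType) (E : Q -> {set 'I_r * Q}).

(** Effect on the value of a word of putting the digit [a] in front of it. *)
Definition contr (a : 'I_r) (x : R) : R := (a%:R + x) / r%:R.

(** [E q] lists the labelled edges leaving [q]. Solutions are not unique: the empty family is always
    one, so comparisons must control where a solution is nonempty. *)
Definition self_affine (X : Q -> set R) : Prop :=
  forall q, X q = \bigcup_(e in [set` E q]) (contr e.1 @` X e.2).

Let rneq0 : r%:R != 0 :> R. Proof. by rewrite pnatr_eq0 -lt0n ltnW. Qed.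

Definition expand (a : 'I_r) (y : R) : R := y * r%:R - a%:R.

Lemma contrK a : cancel (contr a) (expand a).
Proof. by move=> x; rewrite /contr /expand divfK// addrC addKr. Qed.

Lemma expandK a : cancel (expand a) (contr a).
Proof. by move=> x; rewrite /contr /expand addrC subrK mulfK. Qed.

Lemma continuous_contr a : continuous (contr a).
Proof.
move=> x; apply: cvgM; last exact: cvg_cst.
by apply: cvgD; [exact: cvg_cst|exact: cvg_id].
Qed.

Lemma continuous_expand a : continuous (expand a).
Proof.
move=> x; apply: cvgB; last exact: cvg_cst.
by apply: cvgM; [exact: cvg_id|exact: cvg_cst].
Qed.

Lemma self_affine_closure X :
  self_affine X -> self_affine (fun q => closure (X q)).
Proof.
move=> sX q; rewrite {1}sX closure_finite_bigcup; apply: eq_bigcupr => e _.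
by rewrite (@closure_homeo _ _ _ (expand e.1) (@continuous_contr _)
  (@continuous_expand _) (@contrK _) (@expandK _)).
Qed.

Lemma self_affine_limit_point X :
  self_affine X -> self_affine (fun q => limit_point (X q)).
Proof.
move=> sX q; rewrite {1}sX limit_point_finite_bigcup; apply: eq_bigcupr => e _.
by rewrite (@limit_point_homeo _ _ _ (expand e.1) (@continuous_contr _)
  (@continuous_expand _) (@contrK _) (@expandK _)).
Qed.

(** Follow [n] edges backwards from [x], take any point of [Y] at the state reached, which lies
    within distance 1, and map it forward along the same edges. The result is a point of [Y q]
    within [r^-n] of [x], and [Y q] is closed. *)
Lemma self_affine_subset (X Y : Q -> set R) :
  self_affine X -> self_affine Y ->
  (forall q, X q `<=` `[0, 1]) -> (forall q, Y q `<=` `[0, 1]) ->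
  (forall q, closed (Y q)) -> (forall q, X q !=set0 -> Y q !=set0) ->
  forall q, X q `<=` Y q.
Proof.
move=> sX sY X01 Y01 cY XY q x Xx.
have approx n p z : X p z -> exists2 y, Y p y & `|z - y| <= r%:R^-1 ^+ n.
  elim: n p z => [|n IHn] p z Xz.
    have [y Yy] := XY p (ex_intro _ z Xz).
    exists y => //; rewrite expr0.
    have := X01 _ _ Xz; have := Y01 _ _ Yy; rewrite /= !in_itv/= ler_norml.
    by move=> /andP[? ?] /andP[? ?]; lra.
  move: Xz; rewrite {1}sX => -[e Ee [z' Xz' <-]].
  have [y' Yy' zy'] := IHn _ _ Xz'.
  exists (contr e.1 y'); first by rewrite sY; exists e => //; exists y'.
  rewrite /contr -mulrBl opprD addrACA subrr add0r normrM exprSr.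
  by rewrite [`|r%:R^-1|]ger0_norm ?invr_ge0// ler_wpM2r ?invr_ge0.
rewrite [Y q](closure_id _).1// => U /nbhs_ballP[e /= e0 eU].
have : (fun n => r%:R^-1 ^+ n : R) @ \oo --> (0 : R).
  apply: cvg_expr.
  by rewrite ger0_norm ?invr_ge0// invf_lt1 ?ltr1n// ltr0n ltnW.
move=> /cvgrPdist_lt /(_ e e0)[N _ /(_ N (leqnn N))] /=.
rewrite sub0r normrN ger0_norm ?exprn_ge0 ?invr_ge0// => Ne.
have [y Yy xy] := approx N _ _ Xx.
by exists y; split => //; apply: eU; exact: le_lt_trans xy Ne.
Qed.

Definition derived (m : nat) (X : Q -> set R) (q : Q) : set R :=
  iter m limit_point (X q).

Section derived_sets.
Variable X : Q -> set R.
Hypotheses (sX : self_affine X) (cX : forall q, closed (X q)).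
Hypothesis X01 : forall q, X q `<=` `[0, 1].

Lemma self_affine_derived m : self_affine (derived m X).
Proof. by elim: m => //= m; exact: self_affine_limit_point. Qed.

Lemma derived_closed m q : closed (derived m X q).
Proof.
case: m => [|m]; first exact: cX.
by apply: limit_point_closed; exact: hausdorff_accessible (@norm_hausdorff _ _).
Qed.

Lemma derivedS m q : derived m.+1 X q `<=` derived m X q.
Proof.
move=> x; rewrite [derived m X q](closure_id _).1.
  exact: subset_limit_point.
exact: derived_closed.
Qed.

Lemma derived_sub01 m q : derived m X q `<=` `[0, 1].
Proof.
by elim: m => [|m IHm]; [exact: X01|exact: subset_trans (@derivedS _ _) IHm].
Qed.

(* By [self_affine_subset] the derived family is determined by the set of
   indices at which it is nonempty, and these supports decrease. *)
Lemma derived_stationary : exists m, forall q,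
  derived m.+1 X q = derived m X q.
Proof.
pose S m := [set q | `[< derived m X q !=set0 >]]%SET.
have SS m : S m.+1 \subset S m.
  apply/fintype.subsetP => q; rewrite !inE => -[x Xx].
  by exists x; exact: derivedS Xx.
have [m Sm] : exists m, S m \subset S m.+1.
  apply: contrapT => /forallNP nS.
  (* Each strict decrease of the support costs at least one state, which is impossible after
     [#|Q|.+1] steps. *)
  have cardS m : (#|S m| + m <= #|Q|)%N.
    elim: m => [|m IHm]; first by rewrite addn0 max_card.
    rewrite addnS; apply: leq_trans IHm; rewrite ltn_add2r proper_card//.
    by rewrite properE SS; apply/negP; exact: nS.
  by have := cardS #|Q|.+1; rewrite addnS ltnNge leq_addl.
exists m => q; apply/seteqP; split; first exact: derivedS.
apply: self_affine_subset => {q} [||||q|q].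
- exact: self_affine_derived.
- exact: self_affine_derived.
- exact: derived_sub01.
- exact: derived_sub01.
- exact: derived_closed.
- move=> Xq; have : q \in S m.+1.
    by apply: (fintype.subsetP Sm); rewrite !inE.
  by rewrite !inE.
Qed.

(** A point lost by stage [m] is isolated in some earlier stage, and the isolated points of a set of
    reals are countable. *)
Lemma derived_countable m q : countable (X q `\` derived m X q).
Proof.
apply: (@sub_countable _ _ _ (\bigcup_k isolated (derived k X q))).
  apply: subset_card_le => x [Xx]; elim: m => [//|m IHm] nDx.
  have [Dx|] := pselect (derived m X q x); last exact: IHm.
  exists m => //; have := subset_closure Dx.
  by rewrite closure_isolated_limit_point => -[].
apply: bigcup_countable => [|k _]; first exact: countableP.
exact: countable_isolated.
Qed.

End derived_sets.
End graph_directed_systems.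

(** * Base-[r] expansions and the system of a Büchi automaton *)

Section expansions.
Variables (R : realType) (r : nat) (r_gt1 : (1 < r)%N).
Implicit Type w : nat -> 'I_r.

Let r_gt0 : 0 < r%:R :> R. Proof. by rewrite ltr0n ltnW. Qed.
Let rV_lt1 : `|r%:R^-1| < 1 :> R.
Proof. by rewrite ger0_norm ?invr_ge0// invf_lt1// ltr1n. Qed.

(** The right-hand side is [(r - 1) / r^(i+1)], the term of the largest digit; its series sums to
    1. *)
Let digit_geometric w i :
  (w i)%:R / r%:R ^+ i.+1 <= geometric (1 - r%:R^-1) r%:R^-1 i :> R.
Proof.
rewrite /geometric/= exprS invfM mulrA exprVn.
apply: ler_wpM2r; first by rewrite invr_ge0 exprn_ge0.
rewrite ler_pdivrMr// mulrBl mul1r mulVf ?gt_eqF// lerBrDr natr1 ler_nat.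
exact: ltn_ord.
Qed.

Let digit_ge0 w i : 0 <= (w i)%:R / r%:R ^+ i.+1 :> R.
Proof. by rewrite divr_ge0// exprn_ge0. Qed.

Lemma nu_cvg w :
  [series (w i)%:R / r%:R ^+ i.+1]_i @ \oo --> nu R w.
Proof.
apply: (@series_le_cvg _ _ (geometric (1 - r%:R^-1) r%:R^-1)) => [i|i|i|].
- exact: digit_ge0.
- exact: le_trans (digit_ge0 w i) (digit_geometric w i).
- exact: digit_geometric.
- exact: is_cvg_geometric_series.
Qed.

Lemma nu_itv w : nu R w \in `[0, 1].
Proof.
rewrite in_itv/=; apply/andP; split.
  apply: limr_ge; first exact: nu_cvg.
  by apply: nearW => n; apply: sumr_ge0 => i _; exact: digit_ge0.
have g1 : limn (series (geometric (1 - r%:R^-1) r%:R^-1) : R^nat) = 1.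
  have /(cvg_lim (@Rhausdorff R)) -> : series (geometric (1 - r%:R^-1) r%:R^-1)
      @ \oo --> ((1 - r%:R^-1) / (1 - r%:R^-1) : R).
    exact: cvg_geometric_series.
  rewrite divff//.
  by rewrite subr_eq0 gt_eqF//; exact: le_lt_trans (ler_norm _) rV_lt1.
rewrite -g1; apply: lim_series_le.
- exact: nu_cvg.
- exact: is_cvg_geometric_series.
- exact: digit_geometric.
Qed.

Lemma nu_cons w : nu R w = contr (w 0%N) (nu R (fun i => w i.+1)).
Proof.
apply: cvg_lim => //; rewrite -cvg_shiftS.
under eq_fun => n.
  have -> : [series (w i)%:R / r%:R ^+ i.+1]_i n.+1 =
      contr (w 0%N) ([series (w i.+1)%:R / r%:R ^+ i.+1]_i n) :> R.
    rewrite /series/= big_nat_recl// expr1 /contr mulrDl big_distrl/=.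
    congr (_ + _); apply: eq_bigr => i _.
    by rewrite [r%:R ^+ i.+2]exprSr invfM mulrA.
  over.
apply: continuous_cvg; first exact: continuous_contr.
exact: nu_cvg.
Qed.

Section buchi_automaton.
Variable B : buchi 'I_r.

(** The same automaton restarted at [q]. *)
Definition lang_from (q : buchi_state B) : set (nat -> 'I_r) :=
  buchi_lang (Buchi q (@buchi_trans _ B) (buchi_accept B)).

(** Büchi acceptance depends only on the tail of a run, so the first transition can be split off or
    added. *)
Lemma lang_from_cons q w : lang_from q w <->
  exists2 q', q' \in buchi_trans q (w 0%N) & lang_from q' (fun i => w i.+1).
Proof.
split=> [[rho [[rho0 rhoS] acc]]|[q' qq' [rho [[rho0 rhoS] acc]]]].
  exists (rho 1%N); first by have := rhoS 0%N; rewrite rho0.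
  exists (fun i => rho i.+1); split.
    by split => // i; exact: rhoS.
  move=> n; have [[//|m] nm rm] := acc n.+1.
  by exists m.
exists (fun i => if i is i'.+1 then rho i' else q); split.
  split=> // -[|i]; last exact: rhoS.
  by move: rho0 => /= ->.
by move=> n; have [m nm rm] := acc n; exists m.+1 => //; exact: leqW.
Qed.

Lemma self_affine_lang_from :
  self_affine (fun q => [set e | e.2 \in buchi_trans q e.1]%SET)
    (fun q => @nu R r @` lang_from q).
Proof.
move=> q; apply/seteqP; split=> [_ [w /lang_from_cons[q' qq' Lw] <-]|].
  exists (w 0%N, q'); first by rewrite /= inE.
  exists (nu R (fun i => w i.+1)); last by rewrite -nu_cons.
  by exists (fun i => w i.+1).
move=> y [[a q']]; rewrite /= inE/= => qq' [_ [w Lw <-] <-].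
exists (fun i => if i is i'.+1 then w i' else a); last exact: nu_cons.
by apply/lang_from_cons; exists q'.
Qed.

End buchi_automaton.
End expansions.

(** * Hausdorff dimension of countable sets and of sets containing an interval *)

Section hausdorff.
Variable R : realType.
Local Open Scope ereal_scope.

Lemma diam_ubound (U : set R) x y : U x -> U y -> `|x - y|%:E <= diam U.
Proof. by move=> Ux Uy; apply: ereal_sup_ubound; exists (x, y). Qed.

Lemma diam_subsingleton (U : set R) :
  (forall x y, U x -> U y -> x = y) -> diam U <= 0.
Proof.
move=> U1; apply: ge_ereal_sup => _ [[x y] [/= Ux Uy] <-].
by rewrite (U1 x y)// subrr normr0.
Qed.

Lemma diam_pow_ge0 s (U : set R) : 0 <= diam_pow s U.
Proof. by rewrite /diam_pow; case: ifP => // _; exact: poweR_ge0. Qed.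

(** The singletons form a cover of diameter 0 at every scale, so the [s]-dimensional measure
    vanishes for each [s > 0]. *)
Lemma hausdorff_dim_countable (A : set R) :
  countable A -> hausdorff_dim A <= 0.
Proof.
move=> /countable_injP[f inj].
(* The exponent 0 itself is avoided: there the measure counts points. *)
apply/lee_addgt0Pr => s s0; rewrite add0e.
apply: ereal_inf_lbound; exists s => //.
split; first exact: ltW.
have U1 k : forall x y, (A `&` f @^-1` [set k]) x ->
    (A `&` f @^-1` [set k]) y -> x = y.
  move=> x y [Ax fx] [Ay fy]; apply: inj; rewrite ?inE//.
  by rewrite [f x]fx [f y]fy.
apply/eqP; rewrite eq_le; apply/andP; split.
  apply: ge_ereal_sup => _ [delta /= delta0 <-].
  apply: ereal_inf_lbound; exists (fun k => A `&` f @^-1` [set k]).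
    split=> [k|x Ax]; last by exists (f x).
    by apply: le_trans (diam_subsingleton (U1 k)) _; rewrite lee_fin ltW.
  apply: eseries0 => k _ _; rewrite /diam_pow; case: ifPn => // /set0P[x Ux].
  have -> : diam (A `&` f @^-1` [set k]) = 0.
    apply/eqP; rewrite eq_le diam_subsingleton; last exact: U1.
    by have := diam_ubound Ux Ux; rewrite subrr normr0.
  by rewrite poweR0r// gt_eqF.
apply: le_trans (ereal_sup_ubound _); last by exists 1%R => //=; exact: ltr01.
apply: le_ereal_inf_tmp => _ [U _ <-].
by apply: nneseries_ge0 => k _ _; exact: diam_pow_ge0.
Qed.

(** Comparison with Lebesgue measure: for [s < 1], a nonempty set of diameter [d <= 1] lies in an
    interval of length [2 d <= 2 d^s], so every cover at scale 1 has sum at least [(b - a) / 2]. *)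
Lemma hausdorff_dim_itv (A : set R) (a b : R) :
  (a < b)%R -> `[a, b] `<=` A -> 1 <= hausdorff_dim A.
Proof.
move=> ab abA; apply: le_ereal_inf_tmp => _ [s [s0 Hs] <-].
rewrite lee_fin leNgt; apply/negP => s1.
have : hausdorff_premeasure s 1 A < ((b - a) / 2)%:E.
  apply: (@le_lt_trans _ _ 0); last by rewrite lte_fin divr_gt0// subr_gt0.
  by rewrite -Hs; apply: ereal_sup_ubound; exists 1%R => //=; exact: ltr01.
rewrite ltNge => /negP; apply.
apply: le_ereal_inf_tmp => _ [U [U1 AU] <-].
(* The sets of the cover may fail to be measurable; each nonempty one is enlarged to a closed
   interval centred at one of its points, which causes the factor 2. *)
pose I k : set R := if pselect (U k !=set0) is left Uk then
  let x := sval (cid Uk) in let d := fine (diam (U k)) in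
  [set` `[(x - d)%R, (x + d)%R]]
  else set0.
have mI k : measurable (I k) by rewrite /I; case: pselect.
have UI k : U k `<=` I k.
  rewrite /I; case: pselect => [Uk|/set0P]; last first.
    by move=> /negP; rewrite negbK => /eqP->.
  case: cid => x Ux /= y Uy.
  have := diam_ubound Ux Uy.
  have := U1 k; case: (diam (U k)) => [d _|//|//].
  rewrite lee_fin /= in_itv/= ler_norml => /andP[? ?].
  by apply/andP; split; lra.
have muI k : lebesgue_measure (I k) <= 2%:E * diam_pow s (U k).
  rewrite /I; case: pselect => [Uk|_]; last first.
    by rewrite measure0 mule_ge0// diam_pow_ge0.
  have [x Ux] := Uk; set x' := sval _.
  have Uk0 : (U k == set0) = false.
    by apply/negP => /eqP Uk0; move: Ux; rewrite Uk0.
  rewrite lebesgue_measure_itv/= /diam_pow Uk0.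
  have := diam_ubound Ux Ux; have := U1 k; case: (diam (U k)) => [d|//|//].
  rewrite subrr normr0 !lee_fin => d1 d0; rewrite poweR_EFin -EFinM.
  (* This is where [d <= 1], hence the choice of scale 1, is used. *)
  have dd : (d <= d `^ s)%R.
    have [->|d0'] := eqVneq d 0%R; first exact: powR_ge0.
    by apply: ger1_powR (ltW s1); rewrite lt_neqAle eq_sym d0' d0.
  by case: ifP => _; rewrite /= -?EFinD lee_fin; lra.
have : lebesgue_measure (`[a, b] : set R) <=
    \sum_(k <oo) lebesgue_measure (I k).
  apply: measure_sigma_subadditive => //.
  by move=> x /abA /AU[k _ Ukx]; exists k => //; exact: UI.
move=> /le_trans /(_ (lee_nneseries _ (fun k _ => muI k))).
rewrite lebesgue_measure_itv/= lte_fin ab nneseriesZl; last first.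
  by move=> k _; exact: diam_pow_ge0.
rewrite muleC -lee_pdivrMr// => /(_ (fun _ _ _ => measure_ge0 _ _)).
by rewrite -EFinD -EFinM.
Qed.

End hausdorff.

(** * First-order definability of the derived sets *)

Section definability.
Variables (R : realType) (A : set R).

(** The condition [|x - y| < e] is split into two inequalities without subtraction, so that they can
    be written with the terms of the language. *)
Lemma limit_pointE (E : set R) x : limit_point E x <->
  forall e, 0 < e -> exists y, [/\ E y, y != x, x < y + e & y < x + e].
Proof.
split=> [Ex e e0|Ex U /nbhs_ballP[e /= e0 eU]].
  have [y [yx Ey]] := Ex _ (nbhsx_ballx x e e0).
  rewrite /ball/= ltr_norml => /andP[? ?]; exists y; split => //; lra.
have [y [Ey yx ? ?]] := Ex e e0; exists y; split => //; apply: eU.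
by rewrite /ball/= ltr_norml; apply/andP; split; lra.
Qed.

(** The universal quantifier over [e] is a negated existential. Under both binders [y] has index 0,
    [e] has index 1 and [x] is shifted by two; [phi] is meant to speak of its variable 0. *)
Definition limit_point_formula n (phi : formula n.+2) (x : 'I_n) : formula n :=
  let e : 'I_n.+2 := lift ord0 ord0 in
  let y : 'I_n.+2 := ord0 in
  let x' : 'I_n.+2 := lift ord0 (lift ord0 x) in
  Not (Exists (And (Less (Zero _) (Var (ord0 : 'I_n.+1)))
    (Not (Exists (And (And phi (Not (Eq (Var y) (Var x'))))
      (And (Less (Var x') (Plus (Var y) (Var e)))
           (Less (Var y) (Plus (Var x') (Var e))))))))).

Fixpoint derived_formula m n (x : 'I_n) : formula n :=
  if m is m'.+1 then
    limit_point_formula (derived_formula m' (ord0 : 'I_n.+2)) x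
  else InA (Var x).

Let row_mx_head n (a : R) (v : 'rV[R]_n) :
  row_mx (const_mx a : 'rV_1) v ord0 ord0 = a.
Proof.
have -> : ord0 = lshift n ord0 :> 'I_(1 + n) by apply: val_inj.
by rewrite row_mxEl mxE.
Qed.

Let row_mx_tail n (a : R) (v : 'rV[R]_n) (i : 'I_n) :
  row_mx (const_mx a : 'rV_1) v ord0 (lift ord0 i) = v ord0 i.
Proof.
have -> : lift ord0 i = rshift 1 i by apply: val_inj.
by rewrite row_mxEr.
Qed.

Lemma holds_limit_point_formula n (phi : formula n.+2) (x : 'I_n)
    (E : set R) (v : 'rV[R]_n) :
  (forall w, holds A phi w <-> E (w ord0 ord0)) ->
  holds A (limit_point_formula phi x) v <-> limit_point E (v ord0 x).
Proof.
move=> phiE; rewrite limit_pointE /=.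
split=> [nex e e0|lp [e [+ nex]]].
  apply: contrapT => /forallNP ny; apply: nex; exists e.
  rewrite row_mx_head; split=> // -[y [[/phiE + /eqP]]].
  by rewrite !(row_mx_head, row_mx_tail) => Ey yx [xy yx']; exact: (ny y).
rewrite row_mx_head => /lp[y [Ey /eqP yx xy yx']]; apply: nex; exists y.
by rewrite phiE !(row_mx_head, row_mx_tail).
Qed.

Lemma holds_derived_formula m n (x : 'I_n) (v : 'rV[R]_n) :
  holds A (derived_formula m x) v <-> iter m limit_point A (v ord0 x).
Proof.
elim: m n x v => [//|m IHm] n x v /=.
by apply: holds_limit_point_formula => w; exact: IHm.
Qed.

End definability.

(** * Transfer from the line to row vectors of length 1 *)

Section line.
Variable R : realType.

Definition row1 (x : R) : 'rV[R]_1 := const_mx x.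

Lemma row1K : cancel row1 (fun v => v ord0 ord0).
Proof. by move=> x; rewrite mxE. Qed.

Lemma entryK : cancel (fun v : 'rV[R]_1 => v ord0 ord0) row1.
Proof. by move=> v; apply/rowP => i; rewrite mxE (ord1 i). Qed.

Lemma continuous_row1 : continuous row1.
Proof.
move=> x U /nbhs_ballP[e /= e0 eU]; apply/nbhs_ballP; exists e => // y xy.
by apply: eU; split=> // i j; rewrite !mxE.
Qed.

Lemma continuous_entry : continuous (fun v : 'rV[R]_1 => v ord0 ord0).
Proof. exact: coord_continuous. Qed.

Lemma cantor_subset_row1 (X : set R) : X !=set0 -> compact X ->
  limit_point X = X -> interior X = set0 -> cantor_subset (row1 @` X).
Proof.
move=> [x Xx] cX pX iX.
have cX1 : compact (row1 @` X).
  apply: continuous_compact => //; apply: continuous_subspaceT.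
  exact: continuous_row1.
split=> //.
- by exists (row1 x); exists x.
- suff /perfectP[] : perfect_set (row1 @` X) by [].
  split.
    exact: (compact_closed (@norm_hausdorff _ _) cX1).
  rewrite (limit_point_homeo continuous_row1 continuous_entry row1K entryK).
  by rewrite pX.
(* An interior point of the image pulls back along [row1] to an interior point of [X]. *)
- apply/seteqP; split=> // v; rewrite -(entryK v) => /continuous_row1 nX.
  suff : interior X (v ord0 ord0) by rewrite iX.
  apply: (@filterS _ (nbhs (v ord0 ord0)) _ _ _ _ nX).
  by move=> y [x' Xx' /(can_inj row1K) <-].
Qed.

End line.

(** * The stable derived set of [A] as a Cantor set *)

Theorem theorem2 (R : realType) (r : nat) (hr : (1 < r)%N) (A : set R)
    (A01 : A `<=` `[0, 1]) (clA : closed A) (regA : r_regular r A)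
    (dimA_gt0 : (0 < hausdorff_dim A)%E) (dimA_lt1 : (hausdorff_dim A < 1)%E) :
  exists (n : nat) (X : set 'rV[R]_n), cantor_subset X /\ definable A X.
Proof.
have [_ [B ->] AL] := regA.
(* The value sets at states other than the initial one need not be closed, hence the closure; at the
   initial state it changes nothing because [A] is closed. *)
pose X q := closure (@nu R r @` lang_from (B := B) q).
have sX := self_affine_closure hr (self_affine_lang_from R hr (B := B)).
have cX q : closed (X q) by exact: closed_closure.
have X01 q : X q `<=` `[0, 1].
  rewrite [Y in _ `<=` Y](closure_id _).1; last exact: itv_closed.
  by apply: closure_subset => _ [w _ <-]; exact: nu_itv.
have XA : X (buchi_init B) = A.
  rewrite [RHS](closure_id _).1// AL /X /lang_from.
  by case: (B).
have [m Dm] := derived_stationary hr sX cX X01.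
pose D := derived m X (buchi_init B).
have DA : D `<=` A.
  rewrite -XA /D; elim: (m) => // k; apply: subset_trans.
  exact: derivedS.
exists 1%N, (@row1 R @` D); split; last first.
  exists (derived_formula m ord0); apply/seteqP; split=> v.
    by move=> [x Dx <-]; apply/holds_derived_formula; rewrite mxE -XA.
  move=> /holds_derived_formula; rewrite -XA => Dv.
  by exists (v ord0 ord0); rewrite ?entryK.
apply: cantor_subset_row1.
(* If [D] were empty, all of [A] would have been removed, so [A] would be countable and of dimension
   0. *)
- apply/set0P/eqP => D0; have := derived_countable X m (buchi_init B).
  rewrite -/D D0 setD0 XA => /hausdorff_dim_countable.
  by rewrite leNgt dimA_gt0.
- apply: (subclosed_compact _ (@segment_compact R 0 1)).
    exact: derived_closed.
  exact: derived_sub01.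
- exact: Dm.
- apply/seteqP; split=> // x /nbhs_ballP[e /= e0 eD].
  have := dimA_lt1; rewrite ltNge => /negP; apply.
  (* Halving the radius fits a closed interval into the open ball. *)
  apply: (@hausdorff_dim_itv _ _ (x - e / 2) (x + e / 2)); first lra.
  move=> y; rewrite /= in_itv/= => /andP[? ?]; apply: DA; apply: eD.
  by rewrite /ball/= ltr_norml; apply/andP; split; lra.
Qed.
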